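(* Let $p$ be a prime and let $\chi,\psi$ be two non-trivial Dirichlet characters modulo $p$. Then $$\sum_{n\,(\mathrm{mod}\ p)}\ \sum_{m\,(\mathrm{mod}\ p)}S(n,1,1,m;p^2,p^2)\,\chi(-n)\psi(-m)=\tau(\overline{\chi\psi})\,\tau(\chi)^3\,\tau(\psi)^3.$$
   Context: $e(x)=e^{2\pi ix}$ and $\tau(\chi)=\sum_{a\,(\mathrm{mod}\ p)}\chi(a)e(a/p)$ is the Gauss sum of a character $\chi$ modulo $p$ (for the trivial character modulo $p$ the sum is over $a$ coprime to $p$). For integers $n_1,m_2,m_1,n_2$ and positive integers $D_1,D_2$ the (long Weyl element) $\mathrm{GL}(3)$ Kloosterman sum is $$S(n_1,m_2,m_1,n_2;D_1,D_2)=\sum_{\substack{B_1,C_1\,(\mathrm{mod}\ D_1)\\ B_2,C_2\,(\mathrm{mod}\ D_2)\\ D_1C_2+B_1B_2+D_2C_1\equiv0\,(\mathrm{mod}\ D_1D_2)\\ (B_j,C_j,D_j)=1}}e\Big(\frac{n_1B_1+m_1(Y_1D_2-Z_1B_2)}{D_1}+\frac{m_2B_2+n_2(Y_2D_1-Z_2B_1)}{D_2}\Big),$$ where $Y_jB_j+Z_jC_j\equiv1\pmod{D_j}$ for $j=1,2$. In the claim $n,m$ run over representatives of the residue classes modulo $p$; terms with $p\mid nm$ vanish because $\chi(-n)\psi(-m)=0$, and the sum is independent of the choice of representatives. *)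

(* Defs.v *)
From mathcomp Require Import all_boot all_order all_algebra.
From mathcomp Require Import all_classical all_reals all_analysis.
From mathcomp Require Import ring complex.

Set Implicit Arguments.
Unset Strict Implicit.
Unset Printing Implicit Defensive.

Import Order.TTheory GRing.Theory Num.Theory.

Local Open Scope ring_scope.
Local Open Scope complex_scope.

Definition e (R : realType) (x : R) : R[i] :=
  cos (2 * pi * x) +i* sin (2 * pi * x).

(* A Dirichlet character modulo [q], extended by [0] to the integers that are
   not coprime to [q].  Multiplicativity and [chi 1 != 0] give [chi 1 = 1]. *)
Definition dirichlet_character (R : realType) (q : nat) (chi : int -> R[i]) :
    Prop :=
  [/\ forall a b : int, chi (a * b) = chi a * chi b,
      forall a : int, chi (a + q%:Z) = chi a
    & forall a : int, (chi a != 0) = coprimez a q%:Z].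

Definition nontrivial_character (R : realType) (q : nat) (chi : int -> R[i]) :
    Prop :=
  exists2 a : int, coprimez a q%:Z & chi a != 1.

(* As characters vanish off the residues coprime to [q], the sum for the
   trivial character only involves [a] coprime to [q]. *)
Definition gauss_sum (R : realType) (q : nat) (chi : int -> R[i]) : R[i] :=
  \sum_(a < q) chi a%:Z * e (a%:R / q%:R : R).

(* An arbitrary pair [(Y, Z)] with [Y B + Z C = 1 (mod D)], and [(0, 0)] if
   there is none. *)
Definition bezout_mod (D B C : int) : int * int :=
  xget (0, 0) [set YZ : int * int | (YZ.1 * B + YZ.2 * C = 1 %[mod D])%Z].

Lemma bezout_modP (D B C : int) : gcdz (gcdz B C) D = 1 ->
  let YZ := bezout_mod D B C in (YZ.1 * B + YZ.2 * C = 1 %[mod D])%Z.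
Proof.
move=> gBCD /=; rewrite /bezout_mod.
case: (Bezoutz B C) => u [v huv]; case: (Bezoutz (gcdz B C) D) => s [t].
rewrite gBCD => hst.
apply: (@xgetPex _ (0, 0)
  [set YZ : int * int | (YZ.1 * B + YZ.2 * C = 1 %[mod D])%Z]).
exists (s * u, s * v) => /=.
rewrite -!mulrA -mulrDr huv -hst.
by rewrite addrC modzMDl.
Qed.

(* The long Weyl element GL(3) Kloosterman sum, computed on the representatives
   [0 <= B_j, C_j < D_j].  The congruence modulo [D1 * D2] is not invariant
   under [B1 := B1 + D1] alone, but it is under
   [(B1, C2) := (B1 + D1, C2 - B2)], which does not change the term either (and
   symmetrically for [(B2, C1)]); hence the sum does not depend on the choice of
   representatives. *)
Definition kloosterman_GL3 (R : realType) (n1 m2 m1 n2 : int) (D1 D2 : nat) :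
    R[i] :=
  \sum_(B1 < D1) \sum_(C1 < D1) \sum_(B2 < D2) \sum_(C2 < D2 |
      [&& (D1 * C2 + B1 * B2 + D2 * C1 == 0 %[mod D1 * D2])%N,
          gcdn (gcdn B1 C1) D1 == 1%N & gcdn (gcdn B2 C2) D2 == 1%N])
    let: (Y1, Z1) := bezout_mod D1%:Z B1%:Z C1%:Z in
    let: (Y2, Z2) := bezout_mod D2%:Z B2%:Z C2%:Z in
    e ((n1 * B1%:Z + m1 * (Y1 * D2%:Z - Z1 * B2%:Z))%:~R / D1%:R
       + (m2 * B2%:Z + n2 * (Y2 * D1%:Z - Z2 * B1%:Z))%:~R / D2%:R : R).

(* The term of the Kloosterman sum does not depend on the choice of [Y1, Z1];
   the hypotheses are symmetric in the indices 1 and 2, so this also covers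
   [Y2, Z2]. *)
Lemma bezout_mod_indep (D1 D2 B1 C1 B2 C2 Y Z Y' Z' : int) :
  (D1 * C2 + B1 * B2 + D2 * C1 = 0 %[mod D1 * D2])%Z ->
  (Y * B1 + Z * C1 = 1 %[mod D1])%Z -> (Y' * B1 + Z' * C1 = 1 %[mod D1])%Z ->
  (Y * D2 - Z * B2 = Y' * D2 - Z' * B2 %[mod D1])%Z.
Proof.
move=> /eqP; rewrite eqz_mod_dvd subr0 => /dvdzP[k /eqP].
rewrite -subr_eq0; set Ek := _ - _ => /eqP Ek0.
move=> /eqP; rewrite eqz_mod_dvd => /dvdzP[u /eqP].
rewrite -subr_eq0; set Eu := _ - _ => /eqP Eu0.
move=> /eqP; rewrite eqz_mod_dvd => /dvdzP[v /eqP].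
rewrite -subr_eq0; set Ev := _ - _ => /eqP Ev0.
pose y := Y - Y'; pose z := Z - Z'; pose w := y * D2 - z * B2.
apply/eqP; rewrite eqz_mod_dvd; apply/dvdzP.
exists (Y * ((u - v) * D2 - z * (k * D2 - C2))
        + Z * (y * (k * D2 - C2) - (u - v) * B2) - w * u).
apply/eqP; rewrite -subr_eq0; apply/eqP.
transitivity (Y * (D2 * (Eu - Ev) - z * Ek) + Z * (y * Ek - B2 * (Eu - Ev))
              - w * Eu).
  by rewrite /w /y /z /Eu /Ev /Ek; ring.
by rewrite Ek0 Eu0 Ev0 !(subrr, mulr0, addr0).
Qed.

(* Main.v *)
Require Import Defs.
From mathcomp Require Import all_boot all_order all_algebra.
From mathcomp Require Import all_classical all_reals all_analysis.
From mathcomp Require Import complex.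
From mathcomp Require Import ring lra finfield.

Set Implicit Arguments.
Unset Strict Implicit.
Unset Printing Implicit Defensive.

Import Order.TTheory GRing.Theory Num.Theory.

Local Open Scope ring_scope.

(** Write N = p ^ 2.  The congruence modulo N ^ 2 in the Kloosterman sum forces
    N to divide B1 * B2, and together with the coprimality conditions it forces
    C1 and C2 to be units modulo p ([long_weyl_condP]).  One may therefore take
    Y_j = 0 and Z_j = 1 / C_j, so that each term is the additive character of
    Z/N at n B1 + B2 - B2 / C1 - m B1 / C2, and C1, C2 are bound by
    B1 B2 / N + C1 + C2 = 0.

    The terms with p | m vanish with psi(-m), so let p not divide m.  If p does
    not divide B1 then B2 = 0, and what remains is a Ramanujan sum modulo p ^ 2
    at an integer prime to p, which vanishes.  The same happens if p does not
    divide B2.  If B1 = p b1 and B2 = p b2, the term only depends on b1, b2, C1,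
    C2 modulo p, and each residue of C1 modulo p has p lifts.  This gives
    [kloosterman_sqr]: the Kloosterman sum is p times the sum over F_p of e of

      (n b1 + b2 - b2 / c1 - m b1 / c2) / p

    over b1, b2 and nonzero c1, c2 with b1 b2 + c1 + c2 = 0.

    The rest is the classical calculus of Gauss and Jacobi sums.  Summing over
    n and m against chi(-n) psi(-m) produces tau(chi) tau(psi); eliminating c2
    and substituting t = 1 / b1, the sums over b2 and over t each produce one
    more Gauss sum, and the sum left over c1 is the Jacobi sum of psi and the
    inverse of chi psi ([sum_reduced_kloosterman]).  The product of these two
    characters is the inverse of chi, which is nontrivial, so the Jacobi sum
    times tau(1 / chi) is tau(psi) tau(1 / (chi psi)), even when chi psi is
    trivial.  Finally tau(chi) tau(1 / chi) = chi(-1) p. *)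

(** * Gauss and Jacobi sums over a finite field *)

(** Multiplicative characters are extended by 0, as Dirichlet characters are. *)
Definition mult_char (F : finFieldType) (C : fieldType) (f : F -> C) :=
  [/\ {morph f : x y / x * y}, f 1 = 1 & f 0 = 0].

Definition nontrivial_char (F : finFieldType) (C : fieldType) (f : F -> C) :=
  exists2 a, a != 0 & f a != 1.

Definition add_char (A : finPzRingType) (C : fieldType) (h : A -> C) :=
  h 0 = 1 /\ {morph h : x y / x + y >-> x * y}.

Section AddChar.
Context (A : finPzRingType) (C : fieldType) (h : A -> C).
Hypothesis hP : add_char h.

(** Translation by [a] permutes the sum and multiplies it by [h a]. *)
Lemma add_char_sum0 (a : A) : h a != 1 -> \sum_x h x = 0.
Proof.
case: hP => h0 hD ha1; apply/eqP.
have : (h a - 1) * \sum_x h x == 0.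
  rewrite mulrBl mul1r subr_eq0 mulr_sumr.
  rewrite [X in _ == X](reindex_inj (addrI a)) /=.
  by apply/eqP/eq_bigr => x _; rewrite hD.
by rewrite mulf_eq0 subr_eq0 (negPf ha1).
Qed.
End AddChar.

Section Gauss.
Context (F : finFieldType) (C : fieldType) (h : F -> C).
Hypotheses (hP : add_char h) (hnt : exists a, h a != 1).

Definition gauss (f : F -> C) := \sum_x f x * h x.

(** The inverse character; it sends 0 to 0 because [0^-1 = 0]. *)
Definition char_inv (f : F -> C) (x : F) := f x^-1.

Lemma add_char_ortho (b : F) : \sum_x h (x * b) = if b == 0 then #|F|%:R else 0.
Proof.
case: hnt => a ha; case: ifPn => [/eqP->|b0].
  under eq_bigr do rewrite mulr0 hP.1.
  by rewrite sumr_const.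
rewrite (reindex_inj (mulIf (invr_neq0 b0))) /=.
under eq_bigr do rewrite mulfVK //.
exact: add_char_sum0 hP _ ha.
Qed.

Section OneChar.
Context (f : F -> C).
Hypotheses (fP : mult_char f).

Lemma mult_charV_mul x : x != 0 -> f x * f x^-1 = 1.
Proof. by case: fP => fM f1 f0 x0; rewrite -fM divff. Qed.

Lemma mult_charV : mult_char (char_inv f).
Proof.
case: fP => fM f1 f0.
by split=> [x y||]; rewrite /char_inv ?invfM ?invr1 ?invr0.
Qed.

(** Scaling by [a] permutes the sum and multiplies it by [f a]. *)
Lemma mult_char_sum0 : nontrivial_char f -> \sum_x f x = 0.
Proof.
case: fP => fM f1 f0 [a a0 fa1]; apply/eqP.
have : (f a - 1) * \sum_x f x == 0.
  rewrite mulrBl mul1r subr_eq0 mulr_sumr.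
  rewrite [X in _ == X](reindex_inj (mulfI a0)) /=.
  by apply/eqP/eq_bigr => x _; rewrite fM.
by rewrite mulf_eq0 subr_eq0 (negPf fa1).
Qed.

(** For [b != 0], substitute [x / b] for [x].  For [b = 0] both sides vanish,
    the left one because [f] is nontrivial; so the formula holds for all [b],
    which is what allows the later sums to range over the whole field. *)
Lemma gauss_twist (b : F) : nontrivial_char f ->
  \sum_x f x * h (x * b) = f b^-1 * gauss f.
Proof.
case: (fP) => fM f1 f0 fnt; have [->|b0] := eqVneq b 0.
  rewrite invr0 f0 mul0r -[RHS](mult_char_sum0 fnt).
  by apply: eq_bigr => x _; rewrite mulr0 hP.1 mulr1.
rewrite (reindex_inj (mulIf (invr_neq0 b0))) /= mulr_sumr.
by apply: eq_bigr => x _; rewrite mulfVK // fM mulrCA mulrA.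
Qed.

(** Absorbing [f y^-1] into the first Gauss sum by [gauss_twist] leaves the sum
    of [f x * h (y * (x + 1))]; orthogonality in [y] selects [x = -1]. *)
Lemma gauss_inv : nontrivial_char f ->
  gauss f * gauss (char_inv f) = f (-1) * #|F|%:R.
Proof.
move=> fnt; rewrite mulrC mulr_suml.
transitivity (\sum_x f x * \sum_y h (y * (x + 1))).
  under [RHS]eq_bigr do rewrite mulr_sumr.
  rewrite [RHS]exchange_big; apply: eq_bigr => y _ /=.
  rewrite mulrAC -(gauss_twist y fnt) mulr_suml; apply: eq_bigr => x _.
  by rewrite -mulrA -hP.2 mulrDr mulr1 (mulrC y).
under eq_bigr do rewrite add_char_ortho.
rewrite (bigD1 (-1)) //= addNr eqxx big1 ?addr0 // => x xN1.
by rewrite addr_eq0 (negPf xN1) mulr0.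
Qed.

End OneChar.

Definition jacobi (f g : F -> C) := \sum_x f x * g (1 - x).

Lemma mult_charM (f g : F -> C) :
  mult_char f -> mult_char g -> mult_char (fun x => f x * g x).
Proof.
move=> [fM f1 f0] [gM g1 g0]; split=> [x y||]; last 2 first.
- by rewrite f1 g1 mulr1.
- by rewrite f0 mul0r.
by rewrite fM gM mulrACA.
Qed.

(** Sort the terms of the product of the two Gauss sums by the sum [s] of the
    two variables: a nonzero [s] contributes a multiple of the Jacobi sum by
    homogeneity, and [s = 0] contributes a multiple of the sum of the nontrivial
    character [f * g], that is 0. *)
Lemma jacobi_gauss (f g : F -> C) : mult_char f -> mult_char g ->
  nontrivial_char (fun x => f x * g x) ->
  jacobi f g * gauss (fun x => f x * g x) = gauss f * gauss g.
Proof.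
move=> fP gP fgnt; have fgP := mult_charM fP gP.
case: (fP) (gP) => fM f1 f0 [gM g1 g0].
transitivity (\sum_s h s * \sum_x f x * g (s - x)); last first.
  rewrite mulr_suml; under [LHS]eq_bigr do rewrite mulr_sumr.
  rewrite [LHS]exchange_big; apply: eq_bigr => x _ /=.
  rewrite mulr_sumr (reindex_inj (addrI x)); apply: eq_bigr => y _ /=.
  by rewrite hP.2 (addrC x) addrK; ring.
rewrite [RHS](bigD1 0) //= [X in _ + X](_ : _ = \sum_(s | s != 0)
    h s * (f s * g s) * jacobi f g); last first.
  apply: eq_bigr => s s0; rewrite -mulrA; congr (_ * _).
  rewrite (reindex_inj (mulfI s0)) mulr_sumr; apply: eq_bigr => x _ /=.
  by rewrite -[X in X - _]mulr1 -mulrBr fM gM; ring.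
rewrite -mulr_suml [X in h 0 * X](_ : _ = 0) ?mulr0 ?add0r.
  rewrite mulrC; congr (_ * _); rewrite /gauss (bigD1 0) //= f0 !mul0r add0r.
  by apply: eq_bigr => x _; rewrite mulrC.
transitivity (g (-1) * \sum_x f x * g x).
  rewrite mulr_sumr; apply: eq_bigr => x _.
  by rewrite sub0r -[- x]mulN1r gM mulrCA.
by rewrite (mult_char_sum0 fgP fgnt) mulr0.
Qed.

(** * The twisted moment of the reduced Kloosterman sum *)

Definition reduced_kloosterman_fibre (n m b1 b2 : F) :=
  \sum_(c1 | c1 != 0) \sum_(c2 | (c2 != 0) && (b1 * b2 + c1 + c2 == 0))
    h (n * b1 + b2 - b2 / c1 - m * b1 / c2).

Definition reduced_kloosterman (n m : F) :=
  \sum_b1 \sum_b2 reduced_kloosterman_fibre n m b1 b2.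

Lemma gauss_twistN (f : F -> C) (b : F) : mult_char f -> nontrivial_char f ->
  \sum_x f (- x) * h (x * b) = f (- b^-1) * gauss f.
Proof.
move=> fP fnt; rewrite (reindex_inj oppr_inj) -invrN -(gauss_twist fP _ fnt).
by apply: eq_bigr => x _ /=; rewrite opprK mulNr mulrN.
Qed.

Lemma nontrivial_charV (f : F -> C) : mult_char f ->
  nontrivial_char f -> nontrivial_char (char_inv f).
Proof.
by move=> fP [a a0 fa1]; exists a^-1; rewrite ?invr_eq0 // /char_inv invrK.
Qed.

Lemma exchange_double_sum (I : finType) (P : pred I) (a : I -> F -> F -> C)
    (w : F -> F -> C) :
  \sum_n \sum_m (\sum_(i | P i) a i n m) * w n m =
  \sum_(i | P i) \sum_n \sum_m a i n m * w n m.
Proof.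
under eq_bigr => n _ do under eq_bigr => m _ do rewrite mulr_suml.
under eq_bigr => n _ do rewrite exchange_big /=.
by rewrite exchange_big.
Qed.

(** The sums over [n] and [m] are Gauss sums by [gauss_twistN].  The condition
    then gives [c2 = - (c1 + b1 * b2)], and with [t = b1^-1] the factors
    [g c2 * g b1^-1] combine to [g (- c1 * t - b2)].  Substituting
    [b = - c1 * t - b2] separates [t] from [b], and the sums over [t] and [b]
    are again Gauss sums.  The terms with [b1 = 0], [c2 = 0] or [c1 = 0] vanish
    because the characters do, so they can be added or dropped freely. *)
Lemma sum_reduced_kloosterman (f g : F -> C) :
  mult_char f -> nontrivial_char f -> mult_char g -> nontrivial_char g ->
  \sum_n \sum_m reduced_kloosterman n m * (f (- n) * g (- m)) =
  f (-1) * gauss f ^+ 2 * gauss g ^+ 2 *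
    jacobi g (char_inv (fun x => f x * g x)).
Proof.
move=> fP fnt gP gnt; case: (fP) (gP) => fM f1 f0 [gM g1 g0].
rewrite /reduced_kloosterman /reduced_kloosterman_fibre.
transitivity (\sum_b1 \sum_b2 \sum_(c1 | c1 != 0)
   \sum_(c2 | (c2 != 0) && (b1 * b2 + c1 + c2 == 0)) h (b2 - b2 / c1) *
      (\sum_n f (- n) * h (n * b1)) * (\sum_m g (- m) * h (m * (- b1 / c2)))).
  rewrite exchange_double_sum; apply: eq_bigr => b1 _.
  rewrite exchange_double_sum; apply: eq_bigr => b2 _.
  rewrite exchange_double_sum; apply: eq_bigr => c1 _.
  rewrite exchange_double_sum; apply: eq_bigr => c2 _.
  rewrite -mulrA mulr_suml mulr_sumr; apply: eq_bigr => n _.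
  rewrite mulr_sumr mulr_sumr; apply: eq_bigr => m _.
  have -> : n * b1 + b2 - b2 / c1 - m * b1 / c2 =
     (b2 - b2 / c1) + n * b1 + m * (- b1 / c2) by ring.
  by rewrite !hP.2; ring.
transitivity (gauss f * gauss g * \sum_b1 \sum_b2 \sum_(c | c != 0)
   h (b2 - b2 / c) * f (- b1^-1) * g (- (c * b1^-1) - b2)).
  rewrite mulr_sumr; apply: eq_bigr => b1 _.
  rewrite mulr_sumr; apply: eq_bigr => b2 _.
  rewrite mulr_sumr; apply: eq_bigr => c c0.
  under eq_bigr do rewrite !gauss_twistN //.
  have [->|b10] := eqVneq b1 0.
    rewrite invr0 oppr0 f0 mulr0 mul0r mulr0; apply: big1 => c2 _.
    by rewrite mul0r mulr0 mul0r.
  transitivity (\sum_(c2 | c2 == - (c + b1 * b2))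
     h (b2 - b2 / c) * (f (- b1^-1) * gauss f) * (g (c2 / b1) * gauss g)).
    rewrite [in LHS]big_mkcond [in RHS]big_mkcond /=; apply: eq_bigr => c2 _.
    rewrite addrC addr_eq0 [c + _]addrC; have [->|c20] /= := eqVneq c2 0.
      by rewrite mul0r g0 mul0r mulr0; case: ifP.
    by rewrite [- b1 / c2]mulNr invrN invf_div opprK -mulrA.
  rewrite big_pred1_eq.
  have -> : - (c + b1 * b2) / b1 = - (c / b1) - b2 by field.
  by ring.
rewrite [X in _ * X](_ : _ = gauss f * gauss g *
    (f (-1) * jacobi g (char_inv (fun x => f x * g x)))).
  by ring.
(* From here on, [t] is the inverse of [b1]. *)
rewrite (reindex_inj invr_inj) /=.
transitivity (\sum_(c | c != 0) (\sum_t f (- t) * h (t * (1 - c))) *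
   (\sum_b g b * h (b * (c^-1 - 1)))).
  under eq_bigr => t _ do rewrite exchange_big /=.
  rewrite exchange_big; apply: eq_bigr => c c0 /=.
  rewrite mulr_suml; apply: eq_bigr => t _.
  (* The substitution [b := - c * t - b]. *)
  rewrite mulr_sumr (reindex_inj (addrI (- (c * t)))) (reindex_inj oppr_inj).
  apply: eq_bigr => b _ /=.
  rewrite invrK.
  have -> : - (c * t) - (- (c * t) - b) = b by ring.
  have -> : - (c * t) - b - (- (c * t) - b) / c =
      t * (1 - c) + b * (c^-1 - 1) by field.
  by rewrite hP.2; ring.
rewrite [f (-1) * _]mulr_sumr [RHS]mulr_sumr.
rewrite [in RHS](bigD1 0) //= g0 mul0r mulr0 mulr0 add0r.
apply: eq_bigr => c c0; rewrite gauss_twistN // gauss_twist //.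
have -> : (c^-1 - 1)^-1 = c * (1 - c)^-1.
  by rewrite -invf_div; congr (_^-1); field.
by rewrite /char_inv -[- (1 - c)^-1]mulN1r fM gM; ring.
Qed.

(** The product of [g] and the inverse of [f * g] is the inverse of [f], which
    is nontrivial even when [f * g] is trivial; hence [jacobi_gauss] applies to
    the Jacobi sum in [sum_reduced_kloosterman] in all cases.  The Gauss sum of
    the inverse of [f] is supplied by writing [f (-1) * #|F|%:R] as a product of
    two Gauss sums, so no division by a Gauss sum is needed. *)
Lemma reduced_kloosterman_moment (f g : F -> C) :
  mult_char f -> nontrivial_char f -> mult_char g -> nontrivial_char g ->
  #|F|%:R * \sum_n \sum_m reduced_kloosterman n m * (f (- n) * g (- m)) =
  gauss (char_inv (fun x => f x * g x)) * gauss f ^+ 3 * gauss g ^+ 3.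
Proof.
move=> fP fnt gP gnt; rewrite sum_reduced_kloosterman //.
set k := char_inv _.
have kP : mult_char k by apply/mult_charV/mult_charM.
(* The character [g * k] is the inverse of [f]. *)
have gk x : g x * k x = char_inv f x.
  rewrite /k /char_inv; have [->|x0] := eqVneq x 0.
    by case: fP gP => _ _ f0 [_ _ g0]; rewrite invr0 g0 f0 mul0r.
  by rewrite mulrCA mult_charV_mul // mulr1.
have gauss_gk : gauss (fun x => g x * k x) = gauss (char_inv f).
  by apply: eq_bigr => x _; rewrite gk.
have gknt : nontrivial_char (fun x => g x * k x).
  by have [a a0 fa] := nontrivial_charV fP fnt; exists a; rewrite ?gk.
have Jg := jacobi_gauss gP kP gknt; rewrite gauss_gk in Jg.
have Gf := gauss_inv fP fnt.
transitivity (f (-1) * #|F|%:R * jacobi g k * gauss f ^+ 2 * gauss g ^+ 2).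
  by ring.
rewrite -Gf.
transitivity (jacobi g k * gauss (char_inv f) * gauss f ^+ 3 * gauss g ^+ 2).
  by ring.
by rewrite Jg; ring.
Qed.
End Gauss.

(** * The additive character of the integers modulo q *)

Section AdditiveCharacters.
Context (R : realType).

Lemma eD (x y : R) : e (x + y) = e x * e y.
Proof.
rewrite /e mulrDr cosD sinD; apply/eqP.
by rewrite eq_complex /= eqxx /= addrC (mulrC (sin (2 * pi * x))) eqxx.
Qed.

Lemma e0 : e (0 : R) = 1.
Proof. by rewrite /e mulr0 cos0 sin0. Qed.

Lemma eN (x : R) : e (- x) = (e x)^-1.
Proof.
have exN : e x * e (- x) = 1 by rewrite -eD subrr e0.
have ex0 : e x != 0.
  by apply: contra_eq_neq exN => ->; rewrite mul0r eq_sym oner_eq0.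
by apply: (mulfI ex0); rewrite exN divff.
Qed.

Lemma e1 : e (1 : R) = 1.
Proof. by rewrite /e mulr1 mulrC mulr_natr cos2pi sin2pi. Qed.

Lemma e_int (z : int) : e (z%:~R : R) = 1.
Proof.
have e_nat k : e (k%:R : R) = 1.
  by elim: k => [|k IHk]; rewrite ?e0 // -natr1 eD IHk e1 mulr1.
by case: z => k; rewrite ?e_nat // NegzE mulrNz eN e_nat invr1.
Qed.

Lemma e_frac_mod (q : nat) (z w : int) : (0 < q)%N -> (z = w %[mod q])%Z ->
  e (z%:~R / q%:R : R) = e (w%:~R / q%:R).
Proof.
move=> q0 /eqP; rewrite eqz_mod_dvd => /dvdzP[k zwk].
have -> : z = k * q + w by rewrite -zwk subrK.
rewrite rmorphD rmorphM mulrDl mulfK ?eD ?e_int ?mul1r //.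
by rewrite pnatr_eq0 -lt0n.
Qed.

(** [cos (2 pi x) = 1 - 2 sin (pi x) ^ 2] is less than 1 for [0 < x < 1]. *)
Lemma e_frac_neq1 (q k : nat) : (0 < k < q)%N -> e (k%:R / q%:R : R) != 1.
Proof.
move=> /andP[k0 kq]; have q0 : (0 : R) < q%:R by rewrite ltr0n (ltn_trans k0).
set x := k%:R / q%:R.
have x0 : 0 < x by rewrite divr_gt0 // ltr0n.
have x1 : x < 1 by rewrite ltr_pdivrMr // mul1r ltr_nat.
have s0 : 0 < sin (pi * x).
  by rewrite sin_gt0_pi // mulr_gt0 ?pi_gt0 //= -[ltRHS]mulr1 ltr_pM2l ?pi_gt0.
rewrite eq_complex /= negb_and; apply/orP; left.
have -> : 2 * pi * x = pi * x *+ 2 by rewrite -mulrA mulr_natl.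
rewrite cos_mulr2n cos2sin2 lt_eqF //.
have : 0 < sin (pi * x) ^+ 2 by rewrite exprn_gt0.
lra.
Qed.

Lemma Zp_intK (q : nat) (z : int) : (1 < q)%N ->
  (((z%:~R : 'Z_q) : nat)%:Z = z %[mod q])%Z.
Proof.
move=> q1; have natK k : (((k%:R : 'Z_q) : nat)%:Z = k%:Z %[mod q])%Z.
  by rewrite val_Zp_nat // -modz_nat modz_mod.
have q0 : q%:Z != 0 by rewrite -lt0n ltnW.
have -> : (z%:~R : 'Z_q) = (z %% q)%Z%:~R.
  rewrite {1}(divz_eq z q) rmorphD rmorphM /= -[q%:~R]/(q%:R) pchar_Zp //.
  by rewrite mulr0 add0r.
rewrite -[RHS]modz_mod; move: (modz_ge0 z q0).
by case: (z %% q)%Z => // k _; exact: natK.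
Qed.

Definition Zp_char (q : nat) (x : 'Z_q) : R[i] := e ((x : nat)%:R / q%:R).

Lemma Zp_char_int (q : nat) (z : int) : (1 < q)%N ->
  Zp_char (z%:~R : 'Z_q) = e (z%:~R / q%:R).
Proof. by move=> q1; exact: (e_frac_mod (ltnW q1) (Zp_intK z q1)). Qed.

Lemma Zp_charP (q : nat) : (1 < q)%N -> add_char (@Zp_char q).
Proof.
move=> q1; split; first by rewrite /Zp_char mul0r e0.
move=> x y; rewrite -[x]natr_Zp -[y]natr_Zp -natrD.
by rewrite !(Zp_char_int (Posz _)) // -eD -mulrDl -natrD.
Qed.

Lemma Zp_char_neq1 (q : nat) (x : 'Z_q) : (1 < q)%N -> x != 0 -> Zp_char x != 1.
Proof.
move=> q1 x0; apply: e_frac_neq1; rewrite lt0n.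
rewrite -[X in (_ < X)%N](Zp_cast q1) ltn_ord andbT.
by apply: contra x0 => /eqP x0; apply/eqP/val_inj.
Qed.
End AdditiveCharacters.

(** * From the Kloosterman sum to units modulo the square of a prime *)

Lemma sqr_gt1 (p : nat) : prime p -> (1 < p ^ 2)%N.
Proof. by move=> pp; rewrite (ltn_exp2l 0) ?prime_gt1. Qed.

(** If [p] divided [C1] it would not divide [B1], so [p ^ 2] would divide [B2],
    whence [B2 = 0] as [B2 < p ^ 2].  The congruence would then read
    [C1 + C2 = 0] modulo [p ^ 2], so that [p] would divide [B2] and [C2],
    contradicting the coprimality condition for the index 2.  The hypotheses are
    symmetric in the two indices, so [p] does not divide [C2] either. *)
Lemma long_weyl_condP (p B1 C1 B2 C2 : nat) : prime p ->
  (B1 < p ^ 2)%N -> (B2 < p ^ 2)%N ->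
  [&& (p ^ 2 * C2 + B1 * B2 + p ^ 2 * C1 == 0 %[mod p ^ 2 * p ^ 2])%N,
      gcdn (gcdn B1 C1) (p ^ 2) == 1%N & gcdn (gcdn B2 C2) (p ^ 2) == 1%N]
  = [&& (p ^ 2 %| B1 * B2)%N, ~~ (p %| C1)%N, ~~ (p %| C2)%N
      & (p ^ 2 %| B1 * B2 %/ p ^ 2 + C1 + C2)%N].
Proof.
move=> pp B1N B2N; have N0 : (0 < p ^ 2)%N by rewrite expn_gt0 prime_gt0.
have gcdE B C :
    (gcdn (gcdn B C) (p ^ 2) == 1%N) = ~~ ((p %| B)%N && (p %| C)%N).
  rewrite -/(coprime _ _) coprime_sym coprime_pexpl // prime_coprime //.
  by rewrite dvdn_gcd.
rewrite !gcdE mod0n -/(dvdn _ _).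
have [/dvdnP[k BBk]|NBB] /= := boolP (p ^ 2 %| B1 * B2)%N; last first.
  apply: contraNF NBB => /and3P[+ _ _] => /(dvdn_trans (dvdn_mulr _ (dvdnn _))).
  rewrite dvdn_addl ?(dvdn_mulr _ (dvdnn _)) //.
  by rewrite dvdn_addr ?(dvdn_mulr _ (dvdnn _)).
rewrite BBk mulnK // [(k * _)%N]mulnC -!mulnDr dvdn_pmul2l //.
rewrite -addnA addnC -addnA.
have [kCC|_] /= := boolP (p ^ 2 %| _)%N; last by rewrite !andbF.
rewrite andbT.
have pN : (p %| p ^ 2)%N by rewrite dvdn_exp.
have dvdB B C B' C' : (B < p ^ 2)%N -> (B' < p ^ 2)%N ->
    (B * B' = k * p ^ 2)%N ->
    (p ^ 2 %| k + (C + C'))%N -> (p %| C)%N ->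
    ~~ ((p %| B) && (p %| C))%N -> ~~ ((p %| B') && (p %| C'))%N -> False.
  move=> BN B'N BB kC pC; rewrite pC andbT => pB.
  have cop : coprime (p ^ 2) B by rewrite coprime_pexpl // prime_coprime.
  have B'0 : B' = 0%N.
    apply/eqP; rewrite -leqn0 leqNgt; apply/negP => B'0.
    have : (p ^ 2 %| B')%N by rewrite -(Gauss_dvdr _ cop) BB dvdn_mull.
    by move/dvdn_leq => /(_ B'0); rewrite leqNgt B'N.
  move: BB kC; rewrite B'0 muln0 dvdn0 /= => /esym/eqP.
  rewrite muln_eq0 [(_ ^ _)%N == _]eqn0Ngt N0 orbF => /eqP-> /(dvdn_trans pN).
  by rewrite add0n dvdn_addr // => ->.
apply/andP/andP => [[h1 h2]|[h1 h2]]; last by rewrite !negb_and h1 h2 !orbT.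
split; apply/negP => pC.
  exact: (dvdB _ _ _ _ B1N B2N BBk kCC pC h1 h2).
apply: (dvdB _ _ _ _ B2N B1N _ _ pC h2 h1); first by rewrite mulnC.
by rewrite addnA addnAC -addnA.
Qed.

(** Since [C1] and [C2] are invertible, [(0, Z1)] and [(0, Z2)] are admissible
    choices of Bezout coefficients, and the term does not depend on the choice
    by [bezout_mod_indep]. *)
Lemma kloosterman_termE (R : realType) (N n m B1 C1 B2 C2 : nat) (Z1 Z2 : int) :
  (0 < N)%N ->
  (N * C2 + B1 * B2 + N * C1 == 0 %[mod N * N])%N ->
  gcdn (gcdn B1 C1) N == 1%N -> gcdn (gcdn B2 C2) N == 1%N ->
  (Z1 * C1 = 1 %[mod N])%Z -> (Z2 * C2 = 1 %[mod N])%Z ->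
  (let: (Y1', Z1') := bezout_mod N%:Z B1%:Z C1%:Z in
   let: (Y2', Z2') := bezout_mod N%:Z B2%:Z C2%:Z in
   e ((n%:Z * B1%:Z + 1 * (Y1' * N%:Z - Z1' * B2%:Z))%:~R / N%:R
       + (1 * B2%:Z + m%:Z * (Y2' * N%:Z - Z2' * B1%:Z))%:~R / N%:R : R))
  = e ((n%:Z * B1%:Z + B2%:Z - Z1 * B2%:Z - m%:Z * Z2 * B1%:Z)%:~R / N%:R).
Proof.
move=> N0 /eqP cond g1 g2 ZC1 ZC2.
have := @bezout_modP N B1 C1; case: (bezout_mod N B1 C1) => Y1' Z1' /= bez1.
have := @bezout_modP N B2 C2; case: (bezout_mod N B2 C2) => Y2' Z2' /= bez2.
have {}bez1 := bez1 (congr1 Posz (eqP g1)).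
have {}bez2 := bez2 (congr1 Posz (eqP g2)).
have condZ :
    (N%:Z * C2%:Z + B1%:Z * B2%:Z + N%:Z * C1%:Z = 0 %[mod N%:Z * N%:Z])%Z.
  by rewrite -!PoszM -!PoszD !modz_nat cond.
have condZ' :
    (N%:Z * C1%:Z + B2%:Z * B1%:Z + N%:Z * C2%:Z = 0 %[mod N%:Z * N%:Z])%Z.
  rewrite [X in (X %% _)%Z](_ : _ =
    N%:Z * C2%:Z + B1%:Z * B2%:Z + N%:Z * C1%:Z) //.
  by ring.
rewrite -[Z1 * _]add0r -(mul0r B1%:Z) in ZC1.
rewrite -[Z2 * _]add0r -(mul0r B2%:Z) in ZC2.
have /eqP := bezout_mod_indep condZ bez1 ZC1.
have /eqP := bezout_mod_indep condZ' bez2 ZC2.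
rewrite -mulrDl -rmorphD => i2 i1; apply: e_frac_mod => //; apply/eqP.
move: i1 i2; rewrite !eqz_mod_dvd => i1 i2.
rewrite [X in (_ %| X)%Z](_ : _ =
   (Y1' * N%:Z - Z1' * B2%:Z - (0 * N%:Z - Z1 * B2%:Z)) +
   m%:Z * (Y2' * N%:Z - Z2' * B1%:Z - (0 * N%:Z - Z2 * B1%:Z))); last by ring.
by rewrite rpredD // dvdz_mull.
Qed.

Lemma unit_Zp_sqr (p k : nat) : prime p ->
  ((k%:R : 'Z_(p ^ 2)) \is a GRing.unit) = ~~ (p %| k)%N.
Proof.
move=> pp; rewrite unitZpE ?coprime_pexpl ?prime_coprime //.
exact: sqr_gt1.
Qed.

Lemma Zp_nat_eq0 (q k : nat) : (1 < q)%N -> ((k%:R : 'Z_q) == 0) = (q %| k)%N.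
Proof. by move=> q1; rewrite -val_eqE /= val_Zp_nat. Qed.

Lemma sum_Zp (V : nmodType) (q : nat) (P : pred 'Z_q) (G : 'Z_q -> V) :
  (1 < q)%N ->
  \sum_(x | P x) G x = \sum_(i < q | P i%:R) G i%:R.
Proof.
by case: q P G => [|[|q]] // P G _; apply: eq_big => x; rewrite natr_Zp.
Qed.

Lemma sum_Fp (V : nmodType) (p : nat) (P : pred 'F_p) (G : 'F_p -> V) :
  prime p ->
  \sum_(x | P x) G x = \sum_(i < p | P i%:R) G i%:R.
Proof.
move=> pp; rewrite sum_Zp ?pdiv_id ?prime_gt1 //.
have castE a b : a = b ->
    \sum_(i < a | P i%:R) G i%:R = \sum_(i < b | P i%:R) G i%:R.
  by move=> ->.
by apply: castE; rewrite pdiv_id.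
Qed.

(** The part of the Kloosterman sum with [B1] and [B2] prescribed, written over
    the units of the ring of integers modulo [p ^ 2]. *)
Definition kloosterman_fibre (R : realType) (p n m B1 B2 : nat) : R[i] :=
  \sum_(C1 : 'Z_(p ^ 2) | C1 \is a GRing.unit)
    \sum_(C2 | (C2 \is a GRing.unit) && ((B1 * B2 %/ p ^ 2)%:R + C1 + C2 == 0))
      Zp_char R (n%:R * B1%:R + B2%:R - B2%:R / C1 - m%:R * B1%:R / C2).

Lemma mulVr_mod (q k : nat) : (1 < q)%N -> (k%:R : 'Z_q) \is a GRing.unit ->
  (((k%:R : 'Z_q)^-1 : nat)%:Z * k%:Z = 1 %[mod q])%Z.
Proof.
move=> q1 uk; rewrite -PoszM !modz_nat; congr (Posz _).
by rewrite -!(val_Zp_nat q1) natrM natr_Zp mulVr.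
Qed.

Lemma kloosterman_fibration (R : realType) (p n m : nat) : prime p ->
  kloosterman_GL3 R n%:Z 1 1 m%:Z (p ^ 2) (p ^ 2) =
  \sum_(B1 < p ^ 2) \sum_(B2 < p ^ 2 | (p ^ 2 %| B1 * B2)%N)
    kloosterman_fibre R p n m B1 B2.
Proof.
move=> pp; have q1 : (1 < p ^ 2)%N by exact: sqr_gt1.
apply: eq_bigr => B1 _; rewrite exchange_big [RHS]big_mkcond.
apply: eq_bigr => B2 _ /=.
have condE := fun C1 C2 => long_weyl_condP C1 C2 pp (ltn_ord B1) (ltn_ord B2).
case: ifPn => [NBB|NBB]; last first.
  rewrite big1 // => C1 _; rewrite big_pred0 // => C2.
  by rewrite condE (negPf NBB).
rewrite /kloosterman_fibre sum_Zp // [RHS]big_mkcond; apply: eq_bigr => C1 _ /=.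
rewrite sum_Zp // unit_Zp_sqr //.
case: ifPn => uC1; last first.
  by rewrite big_pred0 // => C2; rewrite condE (negPf uC1) andbF.
apply: eq_big => C2.
  by rewrite condE NBB uC1 unit_Zp_sqr // -!natrD Zp_nat_eq0.
move=> cond; move: (cond); rewrite condE => /and4P[_ _ uC2 _].
case/and3P: cond => cond g1 g2.
rewrite -unit_Zp_sqr // in uC1; rewrite -unit_Zp_sqr // in uC2.
rewrite (kloosterman_termE _ _ _ (ltnW q1) cond g1 g2
  (mulVr_mod q1 uC1) (mulVr_mod q1 uC2)).
rewrite -Zp_char_int //; congr Zp_char.
rewrite !(rmorphB, rmorphD, rmorphM) /= -![(Posz _)%:~R]/(_%:R) !natr_Zp.
by rewrite (mulrC _^-1) -mulrA (mulrC _^-1) mulrA.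
Qed.

(** The units modulo [p ^ 2] are stable under translation by [p], which
    multiplies the sum by the value of the character at [p * k], a nontrivial
    root of unity. *)
Lemma Ramanujan_sum_sqr0 (R : realType) (p k : nat) :
  prime p -> ~~ (p %| k)%N ->
  \sum_(c : 'Z_(p ^ 2) | c \is a GRing.unit) Zp_char R (k%:R / c) = 0.
Proof.
move=> pp pk; have q1 : (1 < p ^ 2)%N by exact: sqr_gt1.
rewrite (reindex_inj invr_inj) /=.
under eq_bigl do rewrite unitrV.
under eq_bigr do rewrite invrK.
set S := \sum_(c | _) _; have [h0 hD] := Zp_charP R q1.
apply/eqP; have : (Zp_char R (k%:R * p%:R : 'Z_(p ^ 2)) - 1) * S == 0.
  rewrite mulrBl mul1r subr_eq0 /S mulr_sumr.
  rewrite [X in _ == X](reindex_inj (addrI p%:R)) /=; apply/eqP/eq_big => c.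
    by rewrite -[c]natr_Zp -natrD !unit_Zp_sqr // dvdn_addr.
  by move=> _; rewrite -hD mulrDr.
rewrite mulf_eq0 subr_eq0 (negPf (Zp_char_neq1 _ _ _)) //.
by rewrite -natrM Zp_nat_eq0 // expnS expn1 dvdn_pmul2r ?prime_gt0.
Qed.

Lemma sum_digits (V : nmodType) (p : nat) (G : nat -> V) :
  \sum_(i < p ^ 2) G i = \sum_(a < p) \sum_(b < p) G (a * p + b)%N.
Proof.
rewrite -(big_mkord xpredT G) expnS expn1 big_nat_mul big_mkord.
apply: eq_bigr => a _.
rewrite -{1}[(a * p)%N]add0n big_addn mulSn addnK big_mkord.
by apply: eq_bigr => b _; rewrite addnC.
Qed.

Lemma sum_multiples (V : nmodType) (p : nat) (G : nat -> V) : (0 < p)%N ->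
  \sum_(i < p ^ 2 | (p %| i)%N) G i = \sum_(a < p) G (p * a)%N.
Proof.
move=> p0; rewrite big_mkcond.
rewrite (sum_digits _ (fun i => if (p %| i)%N then G i else 0)).
apply: eq_bigr => a _.
rewrite (bigD1 (Ordinal p0)) //= addn0 dvdn_mull // mulnC.
rewrite big1 ?addr0 // => b; rewrite -val_eqE /= dvdn_addr ?dvdn_mulr //.
by case: b => -[|b] //= bp _; rewrite gtnNdvd.
Qed.

(** * Reduction modulo p *)

Definition Zp_red (p : nat) (x : 'Z_(p ^ 2)) : 'F_p := (x : nat)%:R.

Lemma Zp_red_nat (p k : nat) : prime p -> Zp_red (k%:R : 'Z_(p ^ 2)) = k%:R.
Proof.
move=> pp; rewrite /Zp_red val_Zp_nat ?sqr_gt1 //.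
rewrite [in RHS](divn_eq k (p ^ 2)) natrD natrM natrX pchar_Fp_0 //.
by rewrite expr0n mulr0 add0r.
Qed.

(** Every residue modulo [p] has [p] lifts modulo [p ^ 2]. *)
Lemma sum_Zp_red (p : nat) (C : pzSemiRingType) (G : 'F_p -> C) : prime p ->
  \sum_(x : 'Z_(p ^ 2)) G (Zp_red x) = p%:R * \sum_c G c.
Proof.
move=> pp; rewrite sum_Zp ?sqr_gt1 //.
under eq_bigr do rewrite Zp_red_nat //.
rewrite (sum_digits _ (fun i => G i%:R)).
transitivity (\sum_(a < p) \sum_c G c); last first.
  by rewrite sumr_const card_ord mulr_natl.
apply: eq_bigr => a _.
rewrite sum_Fp //; apply: eq_bigr => b _.
by rewrite natrD natrM pchar_Fp_0 // mulr0 add0r.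
Qed.

Lemma Zp_red_unit (p : nat) (x : 'Z_(p ^ 2)) : prime p ->
  (x \is a GRing.unit) = (Zp_red x != 0).
Proof.
move=> pp; rewrite -[x]natr_Zp unit_Zp_sqr // Zp_red_nat //.
by rewrite -val_eqE /= val_Fp_nat.
Qed.

Lemma Zp_redD (p : nat) (x y : 'Z_(p ^ 2)) : prime p ->
  Zp_red (x + y) = Zp_red x + Zp_red y.
Proof.
by move=> pp; rewrite -[x]natr_Zp -[y]natr_Zp -natrD !Zp_red_nat // natrD.
Qed.

Lemma Zp_redM (p : nat) (x y : 'Z_(p ^ 2)) : prime p ->
  Zp_red (x * y) = Zp_red x * Zp_red y.
Proof.
by move=> pp; rewrite -[x]natr_Zp -[y]natr_Zp -natrM !Zp_red_nat // natrM.
Qed.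

Lemma Zp_redN (p : nat) (x : 'Z_(p ^ 2)) : prime p -> Zp_red (- x) = - Zp_red x.
Proof.
move=> pp; apply/eqP; rewrite -addr_eq0 -Zp_redD // addNr.
by rewrite -[0]/(0%:R) Zp_red_nat.
Qed.

Lemma Zp_redV (p : nat) (x : 'Z_(p ^ 2)) : prime p -> x \is a GRing.unit ->
  Zp_red x^-1 = (Zp_red x)^-1.
Proof.
move=> pp ux; have x0 : Zp_red x != 0 by rewrite -Zp_red_unit.
by apply: (mulfI x0); rewrite divff // -Zp_redM // divrr.
Qed.

(** The type ['F_p] is the ring of integers modulo [pdiv p], which is [p]. *)
Definition Fp_char (R : realType) (p : nat) : 'F_p -> R[i] :=
  @Zp_char R (pdiv p).

Lemma Zp_char_red (R : realType) (p : nat) (x : 'Z_(p ^ 2)) : prime p ->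
  Zp_char R (p%:R * x) = Fp_char R (Zp_red x).
Proof.
move=> pp; have q1 : (1 < p ^ 2)%N by exact: sqr_gt1.
have p0 : (p%:R : R) != 0 by rewrite pnatr_eq0 -lt0n prime_gt0.
rewrite -[x]natr_Zp Zp_red_nat // -natrM (Zp_char_int R (Posz _)) //.
rewrite /Fp_char (Zp_char_int R (Posz _)) ?pdiv_id ?prime_gt1 //.
rewrite -![(Posz _)%:~R]/(_%:R) natrM natrX expr2 invfM mulrACA.
by rewrite divff // mul1r.
Qed.

Lemma andb_addr_eq0 (A : zmodType) (P : pred A) (x y : A) :
  P y && (x + y == 0) = P (- x) && (y == - x).
Proof.
by rewrite addrC addr_eq0; have [->|] := eqVneq y (- x); rewrite ?andbF ?andbT.
Qed.

(** Here [C2 = - C1], and the sum over [C1] is a Ramanujan sum at [m * B1]. *)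
Lemma kloosterman_fibre0r (R : realType) (p n m B1 : nat) : prime p ->
  ~~ (p %| m)%N -> ~~ (p %| B1)%N -> kloosterman_fibre R p n m B1 0 = 0.
Proof.
move=> pp pm pB1; have q1 : (1 < p ^ 2)%N by exact: sqr_gt1.
rewrite /kloosterman_fibre muln0 div0n.
transitivity (Zp_char R (n%:R * B1%:R : 'Z_(p ^ 2)) *
  \sum_(c : 'Z_(p ^ 2) | c \is a GRing.unit) Zp_char R ((m * B1)%:R / c)).
  rewrite mulr_sumr; apply: eq_bigr => c uc.
  under eq_bigl do
    rewrite add0r (andb_addr_eq0 (fun c => c \is a GRing.unit)) /= unitrN uc.
  rewrite big_pred1_eq -(Zp_charP R q1).2 invrN natrM.
  by rewrite addr0 mul0r subr0 mulrN opprK.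
by rewrite Ramanujan_sum_sqr0 ?mulr0 // Euclid_dvdM // negb_or pm.
Qed.

(** Here [C1 = - C2], and the sum over [C1] is a Ramanujan sum at [B2]. *)
Lemma kloosterman_fibre0l (R : realType) (p n m B2 : nat) : prime p ->
  ~~ (p %| B2)%N -> kloosterman_fibre R p n m 0 B2 = 0.
Proof.
move=> pp pB2; have q1 : (1 < p ^ 2)%N by exact: sqr_gt1.
rewrite /kloosterman_fibre mul0n div0n.
transitivity (Zp_char R (B2%:R : 'Z_(p ^ 2)) *
  \sum_(c : 'Z_(p ^ 2) | c \is a GRing.unit) Zp_char R (B2%:R / c)).
  rewrite (reindex_inj oppr_inj) mulr_sumr /=.
  apply: eq_big => c; rewrite unitrN // => uc.
  under eq_bigl do
    rewrite add0r (andb_addr_eq0 (fun c => c \is a GRing.unit)) /= opprK uc.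
  rewrite big_pred1_eq -(Zp_charP R q1).2 invrN.
  by rewrite !mulr0 mul0r subr0 add0r mulrN opprK.
by rewrite Ramanujan_sum_sqr0 ?mulr0.
Qed.

(** All numerators are divisible by [p], so the terms only depend on the
    residues of [C1] and [C2 = - (b1 * b2 + C1)] modulo [p]. *)
Lemma kloosterman_fibre_red (R : realType) (p n m b1 b2 : nat) : prime p ->
  kloosterman_fibre R p n m (p * b1) (p * b2) =
  p%:R * reduced_kloosterman_fibre (@Fp_char R p) n%:R m%:R b1%:R b2%:R.
Proof.
move=> pp; have N0 : (0 < p ^ 2)%N by rewrite expn_gt0 prime_gt0.
rewrite /reduced_kloosterman_fibre [in RHS]big_mkcond -sum_Zp_red //.
rewrite /kloosterman_fibre big_mkcond; apply: eq_bigr => c1 _.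
rewrite Zp_red_unit //; case: ifPn => // uc1.
rewrite mulnACA mulnn mulKn //.
set k := (b1 * b2)%:R; pose c2 : 'Z_(p ^ 2) := - (k + c1).
have red_c2 : Zp_red c2 = - (b1%:R * b2%:R + Zp_red c1).
  by rewrite Zp_redN // Zp_redD // Zp_red_nat // natrM.
under eq_bigl do rewrite (andb_addr_eq0 (fun c => c \is a GRing.unit)) -/c2.
under [RHS]eq_bigl do rewrite (andb_addr_eq0 (fun c => c != 0)) -red_c2.
rewrite -(Zp_red_unit c2) //.
have [uc2|_] := boolP (c2 \is a GRing.unit); last first.
  by rewrite !big_pred0.
have uc1u : c1 \is a GRing.unit by rewrite Zp_red_unit.
rewrite !big_pred1_eq -(Zp_redV pp uc1u) -(Zp_redV pp uc2).
rewrite -!(Zp_red_nat _ pp) -!Zp_redM // -!Zp_redN // -!Zp_redD //.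
rewrite -Zp_char_red // !natrM; congr Zp_char.
by move: c1^-1 c2^-1 => d1 d2; ring.
Qed.

Lemma dvdn_sqr_mul_lt (p a b : nat) : prime p -> ~~ (p %| a)%N ->
  (p ^ 2 %| a * b)%N -> (b < p ^ 2)%N -> b = 0%N.
Proof.
move=> pp pa; rewrite Gauss_dvdr ?coprime_pexpl ?prime_coprime // => pb bp.
by case: b pb bp => // b /(dvdn_leq (ltn0Sn _)); rewrite ltnNge => ->.
Qed.

(** If [p] does not divide one of [B1] and [B2], the other one is 0 and the
    fibre vanishes; the remaining fibres are those with [B1 = p * b1] and
    [B2 = p * b2]. *)
Lemma kloosterman_sqr (R : realType) (p n m : nat) : prime p -> ~~ (p %| m)%N ->
  kloosterman_GL3 R n%:Z 1 1 m%:Z (p ^ 2) (p ^ 2) =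
  p%:R * reduced_kloosterman (@Fp_char R p) n%:R m%:R.
Proof.
move=> pp pm; have p0 := prime_gt0 pp; rewrite kloosterman_fibration //.
rewrite (bigID (fun B1 : 'I_(p ^ 2) => p %| B1)%N) /=.
rewrite [X in _ + X]big1 ?addr0; last first.
  move=> B1 pB1; apply: big1 => B2 NBB.
  by rewrite (dvdn_sqr_mul_lt pp pB1 NBB) ?kloosterman_fibre0r.
transitivity (\sum_(B1 < p ^ 2 | (p %| B1)%N) \sum_(B2 < p ^ 2 | (p %| B2)%N)
   kloosterman_fibre R p n m B1 B2).
  apply: eq_bigr => B1 pB1.
  rewrite (bigID (fun B2 : 'I_(p ^ 2) => p %| B2)%N) /=.
  rewrite [X in _ + X]big1 ?addr0 => [|B2 /andP[NBB pB2]]; last first.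
    rewrite mulnC in NBB.
    by rewrite (dvdn_sqr_mul_lt pp pB2 NBB) ?kloosterman_fibre0l.
  apply: eq_bigl => B2.
  have [pB2|//] := boolP (p %| B2)%N; last by rewrite andbF.
  by rewrite andbT; have := dvdn_mul pB1 pB2; rewrite mulnn.
under eq_bigr => B1 _ do
  rewrite (sum_multiples (kloosterman_fibre R p n m B1)) //.
rewrite (sum_multiples
  (fun B1 => \sum_(b2 < p) kloosterman_fibre R p n m B1 (p * b2))) //.
rewrite /reduced_kloosterman sum_Fp // mulr_sumr; apply: eq_bigr => b1 _.
rewrite sum_Fp // mulr_sumr; apply: eq_bigr => b2 _.
exact: kloosterman_fibre_red.
Qed.

(** * Dirichlet characters as characters of the prime field *)

Section Lift.
Context (R : realType) (p : nat) (pp : prime p).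

Definition Fp_lift (chi : int -> R[i]) (x : 'F_p) : R[i] := chi (x : nat)%:Z.

Lemma dirichlet_Fp (chi : int -> R[i]) (z : int) : dirichlet_character p chi ->
  chi z = Fp_lift chi z%:~R.
Proof.
move=> [_ per _]; have perM k w : chi (w + k * p%:Z) = chi w.
  have perN n' w' : chi (w' + n'%:Z * p%:Z) = chi w'.
    elim: n' => [|n' IHn]; first by rewrite mul0r addr0.
    by rewrite -addn1 PoszD mulrDl mul1r addrA per IHn.
  case: k => n' //; rewrite -(perN n'.+1) NegzE mulNr subrK //.
have q1 : (1 < pdiv p)%N by rewrite pdiv_id ?prime_gt1.
rewrite /Fp_lift; have := Zp_intK z q1; move: (nat_of_ord (z%:~R : 'F_p)) => k.
rewrite pdiv_id // => /esym/eqP; rewrite eqz_mod_dvd => /dvdzP[c zk].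
by rewrite -(perM c k%:Z) -zk addrC subrK.
Qed.

Lemma Fp_lift_mult (chi : int -> R[i]) : dirichlet_character p chi ->
  mult_char (Fp_lift chi).
Proof.
move=> chiP; have [chiM _ chi0] := chiP; split=> [x y||].
- rewrite -[x]natr_Zp -[y]natr_Zp -natrM.
  by rewrite -!(dirichlet_Fp (Posz _) chiP) PoszM chiM.
- rewrite -[1]/(1%:~R) -dirichlet_Fp //.
  have c1 : chi 1 != 0 by rewrite chi0 /coprimez gcd1z.
  by apply: (mulfI c1); rewrite -chiM !mulr1.
apply/eqP; rewrite /Fp_lift /= -[_ == _]negbK chi0 /coprimez gcd0z.
by rewrite /= eqz_nat neq_ltn prime_gt1 // orbT.
Qed.

Lemma Fp_lift_nontrivial (chi : int -> R[i]) : dirichlet_character p chi ->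
  nontrivial_character p chi -> nontrivial_char (Fp_lift chi).
Proof.
move=> chiP [a ca chia]; exists a%:~R; last by rewrite -dirichlet_Fp.
have [_ _ f0] := Fp_lift_mult chiP; have [_ _ chi0] := chiP.
by apply: contraTneq ca => a0; rewrite -chi0 (dirichlet_Fp _ chiP) a0 f0 eqxx.
Qed.

Lemma gauss_sum_Fp (chi : int -> R[i]) :
  gauss_sum p chi = gauss (@Fp_char R p) (fun x : 'F_p => chi (x : nat)%:Z).
Proof.
rewrite /gauss sum_Fp //; apply: eq_bigr => a _.
rewrite val_Fp_nat // modn_small //; congr (_ * _).
by rewrite /Fp_char (Zp_char_int R (Posz a)) ?pdiv_id ?prime_gt1.
Qed.

(** [f x ^+ p = f (x ^+ p) = f x], so the norm of [f x] is 1 when [x != 0]. *)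
Lemma mult_char_conj (f : 'F_p -> R[i]) (x : 'F_p) : mult_char f ->
  (f x)^* = f x^-1.
Proof.
move=> fP; have [fM f1 f0] := fP.
have [->|x0] := eqVneq x 0; first by rewrite invr0 f0 rmorph0.
have fx : f x * f x^-1 = 1 by exact: mult_charV_mul.
have fx0 : f x != 0.
  by apply: contra_eq_neq fx => ->; rewrite mul0r eq_sym oner_eq0.
have fX k : f (x ^+ k) = f x ^+ k.
  by elim: k => [|k IHk]; rewrite ?expr0 ?f1 // !exprS fM IHk.
apply: (mulfI fx0); rewrite fx -normCK.
have : `|f x| ^+ p = `|f x|.
  have xp : x ^+ p = x by have := expf_card x; rewrite card_Fp.
  by rewrite -normrX -fX xp.
rewrite -[in X in X -> _](prednK (prime_gt0 pp)) exprS -[X in _ = X]mulr1.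
move/mulfI; rewrite normr_eq0 => /(_ fx0) /eqP.
rewrite pexpr_eq1 ?normr_ge0 //; first by move/eqP->; rewrite expr1n.
by rewrite -ltnS prednK ?prime_gt1 ?prime_gt0.
Qed.

End Lift.

(** * The moment of the Kloosterman sum *)

Theorem mainTheorem3 (R : realType) (p : nat) (chi psi : int -> R[i]) :
  prime p ->
  dirichlet_character p chi -> nontrivial_character p chi ->
  dirichlet_character p psi -> nontrivial_character p psi ->
  \sum_(n < p) \sum_(m < p)
      kloosterman_GL3 R n%:Z 1 1 m%:Z (p ^ 2) (p ^ 2)
        * (chi (- n%:Z) * psi (- m%:Z))
  = gauss_sum p (fun a => (chi a * psi a)^* )
      * gauss_sum p chi ^+ 3 * gauss_sum p psi ^+ 3.
Proof.
move=> pp chiP chint psiP psint.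
have q1 : (1 < pdiv p)%N by rewrite pdiv_id ?prime_gt1.
have fP := Fp_lift_mult pp chiP; have gP := Fp_lift_mult pp psiP.
have fnt := Fp_lift_nontrivial pp chiP chint.
have gnt := Fp_lift_nontrivial pp psiP psint.
have [h0 hD] := Zp_charP R q1.
have hnt : exists a, @Fp_char R p a != 1.
  by exists 1; apply: Zp_char_neq1 => //; rewrite oner_eq0.
rewrite !gauss_sum_Fp //.
have -> : gauss (@Fp_char R p)
      (fun x : 'F_p => (chi (x : nat)%:Z * psi (x : nat)%:Z)^* ) =
    gauss (@Fp_char R p) (char_inv (fun x => Fp_lift chi x * Fp_lift psi x)).
  apply: eq_bigr => x _; congr (_ * _).
  by rewrite rmorphM /char_inv -!(mult_char_conj pp).
rewrite -(reduced_kloosterman_moment (conj h0 hD) hnt fP fnt gP gnt) card_Fp //.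
rewrite sum_Fp // mulr_sumr; apply: eq_bigr => n _.
rewrite sum_Fp // mulr_sumr; apply: eq_bigr => m _.
rewrite (dirichlet_Fp _ (- n%:Z) chiP) // (dirichlet_Fp _ (- m%:Z) psiP) //.
rewrite !mulrNz.
rewrite -![(Posz _)%:~R]/(_%:R).
(* The terms with [p %| m] vanish with [psi (- m)]. *)
have [pm|pm] := boolP (p %| m)%N; last by rewrite kloosterman_sqr // -mulrA.
have -> : (m%:R : 'F_p) = 0.
  by apply/eqP; rewrite -val_eqE /= val_Fp_nat // (eqP pm).
by have [_ _ g0] := gP; rewrite oppr0 g0 !mulr0.
Qed.
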